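(* Let $d\ge1$ and let $u$ be an $\mathcal{H}$-harmonic function of a positive Schrödinger operator $\mathcal{H}=\Delta+V$ on $\mathbb{Z}^d$ with $V\le1$. If (a) $u$ is bounded in case $d=1,2$, (b) $u\in O\big(|x|^{(2-d)/2}\big)$ in case $d\ge3$, and $$\liminf_{x\to\infty}|u(x)|\,|x|^{(d-1)/2}\,\mathrm{e}^{|x|}=0,$$ then $u=0$.
   Context: On $\mathbb{Z}^d$, $|x|=(|x_1|^2+\dots+|x_d|^2)^{1/2}$ is the Euclidean norm, and the Laplacian (standard weights $b(x,y)=1$ if $|x-y|=1$ and $0$ otherwise, measure $m=1$) is $\Delta f(x)=\sum_{|y-x|=1}(f(x)-f(y))$ for $f:\mathbb{Z}^d\to\mathbb{R}$. For a potential $V:\mathbb{Z}^d\to\mathbb{R}$, $\mathcal{H}f=\Delta f+Vf$. A function $u:\mathbb{Z}^d\to\mathbb{R}$ is $\mathcal{H}$-harmonic if $\mathcal{H}u=0$ on $\mathbb{Z}^d$. $\mathcal{H}$ is positive if there exists a nontrivial function $w\ge0$ on $\mathbb{Z}^d$ with $\mathcal{H}w\ge0$; equivalently, $\frac12\sum_{|x-y|=1}(\varphi(x)-\varphi(y))^2+\sum_xV(x)\varphi(x)^2\ge0$ (first sum over ordered pairs) for all finitely supported $\varphi$. The limit $x\to\infty$ means that $x$ leaves every finite set, and $f\in O(g)$ means $\limsup_{x\to\infty}|f(x)|/|g(x)|<\infty$. *)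

(* Defs.v *)
From HB Require Import structures.
From mathcomp Require Import all_boot all_order all_algebra.
From mathcomp Require Import all_classical all_reals all_analysis.
Import Order.TTheory GRing.Theory Num.Theory.
Import numFieldNormedType.Exports.

Set Implicit Arguments.
Unset Strict Implicit.
Unset Printing Implicit Defensive.

Local Open Scope classical_set_scope.
Local Open Scope ring_scope.

(* Points of Z^d are integer row vectors. *)
Definition enorm (R : realType) (d : nat) (x : 'rV[int]_d) : R :=
  Num.sqrt (\sum_(i < d) (x ord0 i)%:~R ^+ 2).

Definition neighbours (R : realType) (d : nat) (x : 'rV[int]_d) :
  set 'rV[int]_d := [set y | enorm R (y - x) = 1].

Lemma finite_neighbours (R : realType) (d : nat) (x : 'rV[int]_d) :
  finite_set (neighbours R x).
Proof.
pose g (z : 'rV['I_3]_d) : 'rV[int]_d :=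
  x + map_mx (fun i : 'I_3 => (i : nat)%:Z - 1) z.
apply: (@sub_finite_set _ _ (g @` setT)); last first.
  exact: finite_image.
move=> y /= hy.
have hle i : `|(y - x) ord0 i| <= 1.
  have h1 : \sum_(i < d) ((y - x) ord0 i)%:~R ^+ 2 = 1 :> R.
    rewrite -[LHS]sqr_sqrtr ?sumr_ge0 // => [|j _]; last exact: sqr_ge0.
    by rewrite [Num.sqrt _]hy expr1n.
  have h2 : ((y - x) ord0 i)%:~R ^+ 2 <= 1 :> R.
    rewrite -[leRHS]h1 (bigD1 i) //= lerDl.
    by apply: sumr_ge0 => j _; exact: sqr_ge0.
  have h3 : `|((y - x) ord0 i)%:~R| <= 1 :> R.
    by rewrite -[X in _ <= X]sqrtr1 -sqrtr_sqr ler_sqrt.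
  by rewrite -(ler_int R) intr_norm.
exists (\row_i inord (absz ((y - x) ord0 i + 1))) => //.
rewrite /g; apply/rowP => i; rewrite !mxE.
have := hle i; rewrite !mxE ler_norml => /andP[h1 h2].
have h0 : 0 <= y ord0 i - x ord0 i + 1 by rewrite -lerBlDr sub0r.
rewrite inordK; first by rewrite gez0_abs // addrK addrC subrK.
rewrite -ltz_nat gez0_abs //.
by apply: (@le_lt_trans _ _ (1 + 1)) => //; rewrite lerD2r.
Qed.

(* The finitely supported sum \sum_(y \in A) is 0 by convention on infinite
   supports; [finite_neighbours] shows that this never happens here. *)
Definition laplacian (R : realType) (d : nat) (f : 'rV[int]_d -> R) :
  'rV[int]_d -> R :=
  fun x => \sum_(y \in neighbours R x) (f x - f y).

Definition schrodinger (R : realType) (d : nat) (V f : 'rV[int]_d -> R) :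
  'rV[int]_d -> R :=
  fun x => laplacian f x + V x * f x.

Definition schrodinger_harmonic (R : realType) (d : nat) (V u : 'rV[int]_d -> R) : Prop :=
  forall x, schrodinger V u x = 0.

Definition positive_schrodinger (R : realType) (d : nat)
  (V : 'rV[int]_d -> R) : Prop :=
  exists w : 'rV[int]_d -> R,
    [/\ exists x, w x != 0,
        forall x, 0 <= w x &
        forall x, 0 <= schrodinger V w x].

(* x -> oo means that x leaves every finite set, i.e. the filter is the
   cofinite one. The two limits are limf_esup and limf_einf (cf. limf_esupE and
   limf_einfE) along that filter; those constants ask for a filteredType
   structure on the domain, which integer row vectors do not carry. *)
Definition limsup_infty (R : realType) (T : Type) (f : T -> R) : \bar R :=
  ereal_inf [set ereal_sup ((EFin \o f) @` A) | A in @frechet_filter T].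

Definition liminf_infty (R : realType) (T : Type) (f : T -> R) : \bar R :=
  ereal_sup [set ereal_inf ((EFin \o f) @` A) | A in @frechet_filter T].

(* The quotient is a total function; for a g vanishing only at finitely many
   points, its values there do not affect the limsup. *)
Definition bigO_infty (R : realType) (T : Type) (f g : T -> R) : Prop :=
  (limsup_infty (fun x => (`|f x| / `|g x|)%R) < +oo)%E.

(* Main.v *)
Require Import Defs.
From HB Require Import structures.
From mathcomp Require Import all_boot all_order all_algebra.
From mathcomp Require Import all_classical all_reals all_analysis.
From mathcomp Require Import zify ring lra.
Import Order.TTheory GRing.Theory Num.Theory.
Import numFieldNormedType.Exports.
Local Open Scope classical_set_scope.
Local Open Scope ring_scope.

(** The proof tests positivity with one family of cutoffs and then compares
    with one explicit subsolution.

    Let [w] be the function witnessing positivity. By the Harnack-type lemma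
    [supersolution_gt0] it is positive everywhere. Testing [H w >= 0] with
    [c^2 u^2 / w] and [H u = 0] with [c^2 u], for a finitely supported cutoff
    [c], the potential cancels and summation by parts leaves ([energy_le])

      sum over edges of  w(x) w(y) (c(x) u(x)/w(x) - c(y) u(y)/w(y))^2
        <=  sum over edges of  u(x) u(y) (c(x) - c(y))^2.

    The growth hypotheses imply, in every dimension, that
    [u^2 (1 + |x|)^d <= C (1 + |x|)^2] ([growth_bound]). This is exactly the
    critical growth for logarithmic cutoffs: with harmonic numbers [h_N] and
    [c(x) = h_N - h_min(|x|,N)], where [|x|] is the sup norm, the right-hand
    side is at most [K h_(N+1)] ([cutoff_energy]), whereas a single term with
    [u(x)/w(x) <> u(y)/w(y)] on the left grows like [h_N^2]. As [h_N] is
    unbounded, [u/w] is constant ([harmonic_proportional]): [u = k w].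

    If [k <> 0], then [p = |u|] is positive and [H p = 0], so [V <= 1] gives
    [(Delta + 1) p >= 0]. On the lattice [exp (- |x|)], with the Euclidean
    norm, is a subsolution of [Delta + 1] outside a ball
    ([decay_subsolution]): relative to its value at [x], the neighbours
    contribute [sum_i (2 cosh t_i - 2)] to leading order, with [t = x / |x|],
    and the quartic term of [cosh] brings this strictly above
    [sum_i t_i^2 = 1], which absorbs all errors of order [1 / |x|]. The maximum principle
    ([decay_le_supersolution]) yields [p >= eps exp (- |x|)], and since
    [|x|^((d-1)/2) >= 1] for [x <> 0] this contradicts the vanishing lower
    limit. *)

Set Implicit Arguments.
Unset Strict Implicit.
Unset Printing Implicit Defensive.

(** * The lattice and its Laplacian *)

Definition unitv (d : nat) (i : 'I_d) : 'rV[int]_d := delta_mx ord0 i.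

Lemma unitvE (d : nat) (i j : 'I_d) : unitv i ord0 j = (i == j)%:R.
Proof. by rewrite /unitv mxE eqxx /= eq_sym. Qed.

Lemma sqr_enorm (R : realType) (d : nat) (x : 'rV[int]_d) :
  enorm R x ^+ 2 = \sum_(i < d) (x ord0 i)%:~R ^+ 2.
Proof. by rewrite sqr_sqrtr // sumr_ge0 // => i _; exact: sqr_ge0. Qed.

Lemma enorm_ge0 (R : realType) (d : nat) (x : 'rV[int]_d) : 0 <= enorm R x.
Proof. exact: sqrtr_ge0. Qed.

Lemma sum_sqr_unitv (d : nat) (i : 'I_d) :
  \sum_(j < d) (unitv i ord0 j) ^+ 2 = 1.
Proof.
rewrite (bigD1 i) //= unitvE eqxx expr1n big1 ?addr0 // => j ji.
by rewrite unitvE eq_sym (negbTE ji) expr0n.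
Qed.

(** By integrality, a sum of squares equal to 1 has a single nonzero term; this
    identifies the neighbours of a point. *)
Lemma sum_sqr_eq1 (d : nat) (z : 'rV[int]_d) :
  \sum_(i < d) (z ord0 i) ^+ 2 = 1 -> exists i, z = unitv i \/ z = - unitv i.
Proof.
move=> z1.
have [i zi0] : exists i, z ord0 i != 0.
  apply: contrapT => /forallNP z0; move: z1; rewrite big1 // => i _.
  by have /negP := z0 i; rewrite negbK => /eqP ->; rewrite expr0n.
exists i; move: z1; rewrite (bigD1 i) //=.
have : 0 <= \sum_(j < d | j != i) z ord0 j ^+ 2.
  by apply: sumr_ge0 => j _; exact: sqr_ge0.
have : 1 <= z ord0 i ^+ 2 by move: zi0; nia.
move=> zi1 rest0 z1.
have [zi /eqP] : z ord0 i ^+ 2 = 1 /\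
    \sum_(j < d | j != i) z ord0 j ^+ 2 = 0.
  move: zi1 rest0 z1; set q := _ ^+ 2; set s := \sum_(_ | _) _.
  by move: q s => q s; lia.
rewrite psumr_eq0 => [|j _]; last exact: sqr_ge0.
move=> /allP zj.
have zj0 j : j != i -> z ord0 j = 0.
  move=> ji; have := zj j; rewrite mem_index_enum ji => /(_ isT) /=.
  by rewrite sqrf_eq0 => /eqP.
move: zi => /eqP; rewrite sqrf_eq1 => /orP[] /eqP zi; [left|right];
  apply/rowP => j; rewrite ?mxE ?eqxx /=; case: (eqVneq j i) => [->|/zj0 -> //].
- by rewrite zi.
- by rewrite zi.
Qed.

Lemma enorm_eq1 (R : realType) (d : nat) (z : 'rV[int]_d) :
  enorm R z = 1 <-> exists i, z = unitv i \/ z = - unitv i.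
Proof.
have sumE : \sum_(i < d) (z ord0 i)%:~R ^+ 2 =
            (\sum_(i < d) (z ord0 i) ^+ 2)%:~R :> R.
  by rewrite rmorph_sum; apply: eq_bigr => i _; rewrite rmorphXn.
split=> [z1|[i zi]].
  apply: sum_sqr_eq1; apply/eqP; rewrite -(eqr_int R) -sumE -sqr_enorm z1.
  by rewrite expr1n.
rewrite /enorm sumE.
suff -> : \sum_(i < d) z ord0 i ^+ 2 = 1 by rewrite sqrtr1.
rewrite -(sum_sqr_unitv i); apply: eq_bigr => j _.
by case: zi => ->; rewrite ?mxE ?sqrrN.
Qed.

(** Traversing the neighbours as [x + e_i] and [x - e_i] makes the Laplacian
    an ordinary finite sum over coordinate directions. *)
Lemma laplacianE (R : realType) (d : nat) (f : 'rV[int]_d -> R) x :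
  laplacian f x =
  \sum_(i < d) ((f x - f (x + unitv i)) + (f x - f (x - unitv i))).
Proof.
pose g (k : 'I_d * bool) := if k.2 then x + unitv k.1 else x - unitv k.1.
have gE k : g k = x + (if k.2 then unitv k.1 else - unitv k.1).
  by rewrite /g; case: k.2.
have ginj : set_inj setT g.
  move=> [i b] [j c] _ _; rewrite !gE => /addrI /= /rowP ij.
  have := ij i; have := ij j.
  by case: b {ij}; case: c; rewrite ?mxE !eqxx /=; case: (eqVneq i j) => [->|];
    rewrite ?eqxx // => _.
have -> : laplacian f x = \sum_(y \in g @` setT) (f x - f y).
  apply: eq_fsbigl; apply/seteqP; split=> [y /= |_ /= [[i b] _ <-]].
    rewrite /neighbours /= enorm_eq1 => -[i yi].
    case: yi => yi; [exists (i, true) | exists (i, false)] => //;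
    by rewrite gE /= -yi addrC subrK.
  rewrite /neighbours /= enorm_eq1; exists i; rewrite gE addrC addKr /=.
  by case: b; [left|right].
rewrite fsbig_image //.
transitivity (\sum_(k : 'I_d * bool) (f x - f (g k))).
  rewrite [RHS](@bigfs _ _ _ _ _ xpredT) ?index_enum_uniq //; last first.
    by move=> k _; rewrite mem_index_enum.
  by apply: eq_fsbigl; apply/seteqP; split.
rewrite -(pair_big xpredT xpredT (fun i b => f x - f (g (i, b)))) /=.
by apply: eq_bigr => i _; rewrite big_bool.
Qed.

(** The vectors whose translation preserves [P] form a subgroup, and the unit
    vectors generate the lattice. *)
Lemma lattice_connected (d : nat) (P : 'rV[int]_d -> Prop) :
  (forall x i, P x <-> P (x + unitv i)) -> forall x y, P x -> P y.
Proof.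
move=> step.
pose Q z := forall x, P x <-> P (x + z).
have Q0 : Q 0 by move=> x; rewrite addr0.
have QD y z : Q y -> Q z -> Q (y + z).
  by move=> Qy Qz x; rewrite addrA; apply: iff_trans (Qy _) (Qz _).
have QN y : Q y -> Q (- y).
  by move=> Qy x; rewrite (Qy (x - y)) subrK.
have Qn y n : Q y -> Q (y *+ n).
  move=> Qy; elim: n => [|n IH]; first by rewrite mulr0n.
  by rewrite mulrS; exact: QD.
have Qz y (k : int) : Q y -> Q (k *: y).
  move=> Qy; rewrite -[k]intz scaler_int; case: k => n; first exact: Qn.
  by apply/QN/Qn.
move=> x y.
suff : Q (y - x) by move=> /(_ x); rewrite addrC subrK => ->.
rewrite [y - x]row_sum_delta; apply: big_ind => // i _.
by apply: Qz => z; exact: step.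
Qed.

(** * Boxes *)

Definition supn {d : nat} (x : 'rV[int]_d) : nat := \max_(i < d) `|x ord0 i|%N.

Definition box (d N : nat) : set 'rV[int]_d := [set x | (supn x <= N)%N].
Arguments box : clear implicits.

Lemma supn_leP {d : nat} (x : 'rV[int]_d) N :
  (supn x <= N)%N <-> forall i, (`|x ord0 i| <= N)%N.
Proof.
split=> [/bigmax_leqP h i|h]; first exact: h.
by apply/bigmax_leqP => i _.
Qed.

Lemma supn_addr {d : nat} (x e : 'rV[int]_d) :
  (supn (x + e) <= supn x + supn e)%N.
Proof.
apply/supn_leP => i.
have /supn_leP/(_ i) hx := leqnn (supn x).
have /supn_leP/(_ i) he := leqnn (supn e).
rewrite mxE; move: (x ord0 i) (e ord0 i) (supn x) (supn e) hx he => a b m n; lia.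
Qed.

Lemma supnN {d : nat} (x : 'rV[int]_d) : supn (- x) = supn x.
Proof. by apply: eq_bigr => i _; rewrite mxE abszN. Qed.

Lemma supn_unitv {d : nat} (i : 'I_d) : (supn (unitv i) <= 1)%N.
Proof. by apply/supn_leP => j; rewrite unitvE; case: eqP. Qed.

Lemma supn_step {d : nat} (x : 'rV[int]_d) i :
  (supn (x + unitv i) <= (supn x).+1)%N /\ (supn x <= (supn (x + unitv i)).+1)%N.
Proof.
split; have := supn_unitv i.
  by have := supn_addr x (unitv i); lia.
have := supn_addr (x + unitv i) (- unitv i).
by rewrite supnN addrK; lia.
Qed.

Definition box_param (d N : nat) (z : {ffun 'I_d -> 'I_N.*2.+1}) : 'rV[int]_d :=
  \row_i ((z i : nat)%:Z - N%:Z).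

Lemma box_param_inj (d N : nat) : set_inj setT (@box_param d N).
Proof.
move=> y z _ _ /rowP yz; apply/ffunP => i; apply: val_inj.
by have := yz i; rewrite !mxE /=; lia.
Qed.

Lemma box_image (d N : nat) : box d N = @box_param d N @` setT.
Proof.
apply/seteqP; split=> [x /supn_leP hx|_ /= [z _ <-]].
  exists [ffun i => inord (absz (x ord0 i + N%:Z))] => //.
  apply/rowP => i; rewrite !mxE ffunE; move: (x ord0 i) (hx i) => a ha.
  by rewrite inordK; lia.
by apply/supn_leP => i; rewrite mxE; have := ltn_ord (z i); lia.
Qed.

Lemma finite_box (d N : nat) : finite_set (box d N).
Proof. by rewrite box_image; exact: finite_image. Qed.

Lemma sum_box_const (R : realType) (d N : nat) (c : R) :
  \sum_(x \in box d N) c = c * N.*2.+1%:R ^+ d.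
Proof.
rewrite box_image fsbig_image; last exact: box_param_inj.
transitivity (\sum_(z : {ffun 'I_d -> 'I_N.*2.+1}) c).
  rewrite [RHS](@bigfs _ _ _ _ _ xpredT) ?index_enum_uniq //; last first.
    by move=> k _; rewrite mem_index_enum.
  by apply: eq_fsbigl; apply/seteqP; split.
by rewrite sumr_const card_ffun !card_ord -[LHS]mulr_natr natrX.
Qed.

(** The discrete integration by parts: away from the boundary layer, summation
    over a box is translation invariant. *)
Lemma sum_box_shift (R : realType) (d N : nat) (F : 'rV[int]_d -> R) i :
  (forall x, (N < supn x)%N -> F x = 0) ->
  \sum_(x \in box d N.+1) F (x + unitv i) = \sum_(x \in box d N.+1) F x.
Proof.
move=> F0.
rewrite [LHS](@fsbig_widen _ _ _ _ _ setT) //; last first.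
  move=> x [_ /negP /=]; rewrite -ltnNge => hx; apply: F0.
  by have [_] := supn_step x i; lia.
rewrite [RHS](@fsbig_widen _ _ _ _ _ setT) //; last first.
  by move=> x [_ /negP /=]; rewrite -ltnNge => hx; apply: F0; lia.
rewrite [RHS](@reindex_fsbigT _ _ _ _ _ (fun x => x + unitv i)) //.
by exists (fun x => x - unitv i) => x; rewrite ?addrK ?subrK.
Qed.

Lemma ler_sum_box (R : realType) (d N : nat) (F G : 'rV[int]_d -> R) :
  (forall x, F x <= G x) -> \sum_(x \in box d N) F x <= \sum_(x \in box d N) G x.
Proof.
by move=> FG; rewrite !fsbig_finite ?ler_sum //; exact: finite_box.
Qed.

(** The mean value bound for [x ^+ n], multiplied by [b] to avoid the exponent
    [n - 1]. *)
Lemma subrXX_le (R : realType) (a b : R) n : 0 <= a -> a <= b ->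
  b * (b ^+ n - a ^+ n) <= n%:R * (b - a) * b ^+ n.
Proof.
move=> a0 ab; elim: n => [|n IH]; first by rewrite !expr0 subrr mulr0 !mul0r.
have b0 : 0 <= b by exact: le_trans ab.
have anbn : a ^+ n <= b ^+ n by rewrite lerXn2r ?nnegrE.
rewrite !exprS -[n.+1]addn1 natrD.
have := ler_wpM2l b0 IH.
have : (b - a) * (b * a ^+ n) <= (b - a) * (b * b ^+ n).
  by rewrite ler_wpM2l ?subr_ge0 // ler_wpM2l.
move: (a ^+ n) (b ^+ n) anbn n%:R => A B _ k; lra.
Qed.

(** The sphere of radius [r] has at most a constant times [(1 + r)^(d-1)]
    points, so it contributes at most a constant times [1 / (1 + r)]. The
    sphere is counted as a difference of two boxes. *)
Lemma sum_box_weight (R : realType) (d N : nat) :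
  \sum_(x \in box d N) ((1 + (supn x)%:R) ^- d : R) <=
  d.+1%:R * 2 ^+ d.+1 * series harmonic N.+1.
Proof.
elim: N => [|N IH].
  under eq_fsbigr => x.
    rewrite inE /box /= leqn0 => /eqP ->.
    rewrite addr0 expr1n invr1; over.
  rewrite sum_box_const expr1n mul1r /series /= big_nat1 /= invr1 mulr1.
  by rewrite -{1}[1]mulr1 ler_pM ?ler1n // exprn_ege1 // ler1n.
have -> : box d N.+1 = box d N `|` (box d N.+1 `\` box d N).
  rewrite setDE setUIr setUv setIT; apply/esym/setUidPr => x /=.
  by rewrite /box /= => /leq_trans; apply.
have fD : finite_set (box d N.+1 `\` box d N).
  by apply: finite_setD; exact: finite_box.
rewrite fsbigU0 //; [|exact: finite_box|by move=> x [? []]].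
rewrite seriesSr /= [leRHS]mulrDr; apply: lerD; first exact: IH.
under eq_fsbigr => x.
  rewrite inE => -[/= xN1 /negP]; rewrite -ltnNge => xN.
  have -> : supn x = N.+1 by apply/eqP; rewrite eqn_leq xN1.
  over.
set c := _ ^- d.
have -> : \sum_(x \in box d N.+1 `\` box d N) c =
    c * (N.+1.*2.+1%:R ^+ d - N.*2.+1%:R ^+ d).
  rewrite mulrBr -!sum_box_const; apply/eqP; rewrite eq_sym subr_eq; apply/eqP.
  rewrite addrC -fsbigU0 //; [|exact: finite_box|by move=> x [? []]].
  apply: eq_fsbigl; rewrite setDE setUIr setUv setIT; apply/esym/setUidPr => x /=.
  by rewrite /box /= => /leq_trans; apply.
have c0 : 0 < 1 + N.+1%:R :> R by rewrite ltr_wpDr ?ler0n.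
have := @subrXX_le R N.*2.+1%:R N.+1.*2.+1%:R d (ler0n _ _).
rewrite ler_nat => /(_ ltac:(lia)).
have -> : N.+1.*2.+1%:R - N.*2.+1%:R = 2 :> R by rewrite -natrB; [congr _%:R|]; lia.
set D := _ ^+ d - _ ^+ d => hD.
rewrite -[N.+2%:R]/(N.+1.+1%:R) -[N.+1.+1]add1n natrD /c.
set q := 1 + N.+1%:R in c0 *.
have D0 : 0 <= D.
  by rewrite subr_ge0 lerXn2r ?nnegrE ?ler0n // ler_nat; lia.
rewrite ler_pdivlMr // -mulrA mulrC ler_pdivrMr ?exprn_gt0 // mulrC.
have qb : q <= N.+1.*2.+1%:R by rewrite /q nat1r ler_nat; lia.
have bq : N.+1.*2.+1%:R <= 2 * q :> R by rewrite /q nat1r -natrM ler_nat; lia.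
apply: (le_trans (ler_wpM2r D0 qb)); apply: (le_trans hD).
have bqd : N.+1.*2.+1%:R ^+ d <= (2 * q) ^+ d.
  by rewrite lerXn2r ?nnegrE ?mulr_ge0 ?ler0n // ltW.
apply: (le_trans (ler_wpM2l _ bqd)); first by rewrite mulr_ge0.
rewrite exprMn exprS -natr1 [leRHS](_ : _ = d%:R * 2 * (2 ^+ d * q ^+ d) +
  2 * (2 ^+ d * q ^+ d)); last by ring.
by rewrite lerDl !mulr_ge0 ?exprn_ge0 // ltW.
Qed.

(** * The energy inequality and logarithmic cutoffs *)

(** The two sides of an edge contribute the square of a weighted difference
    after symmetrisation: this is the ground state representation of the
    quadratic form, edge by edge. *)
Lemma edge_identity (R : realType) (cx cy ux uy wx wy : R) :
  wx != 0 -> wy != 0 ->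
  cx ^+ 2 * (ux * uy - ux ^+ 2 * wy / wx) +
  cy ^+ 2 * (uy * ux - uy ^+ 2 * wx / wy) =
  ux * uy * (cx - cy) ^+ 2 - wx * wy * (cx * (ux / wx) - cy * (uy / wy)) ^+ 2.
Proof. by move=> wx0 wy0; field; rewrite wx0 wy0. Qed.

(** Subtracting [H u = 0] tested with [c^2 u] from [H w >= 0] tested with
    [c^2 u^2 / w] eliminates the potential; the rest is summation by parts. *)
Lemma energy_le (R : realType) (d N : nat) (V u w c : 'rV[int]_d -> R) :
  (forall x, 0 < w x) -> (forall x, 0 <= schrodinger V w x) ->
  schrodinger_harmonic V u -> (forall x, (N < supn x)%N -> c x = 0) ->
  \sum_(i < d) \sum_(x \in box d N.+1)
    w x * w (x + unitv i) *
      (c x * (u x / w x) - c (x + unitv i) * (u (x + unitv i) / w (x + unitv i))) ^+ 2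
  <= \sum_(i < d) \sum_(x \in box d N.+1)
    u x * u (x + unitv i) * (c x - c (x + unitv i)) ^+ 2.
Proof.
move=> w0 Hw Hu c0.
(* The contribution of the oriented edge from x to y to the difference of the
   two tested relations. *)
pose A x y := c x ^+ 2 * (u x * u y - u x ^+ 2 * w y / w x).
have wn x : w x != 0 by rewrite gt_eqF.
have A_ge0 x : 0 <= \sum_(i < d) (A x (x + unitv i) + A x (x - unitv i)).
  have : 0 <= c x ^+ 2 * u x ^+ 2 / w x * schrodinger V w x
            - c x ^+ 2 * u x * schrodinger V u x.
    rewrite Hu mulr0 subr0; apply: mulr_ge0; last exact: Hw.
    by apply: divr_ge0; [apply: mulr_ge0; exact: sqr_ge0 | exact: ltW (w0 x)].
  rewrite /schrodinger !laplacianE !mulrDr.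
  rewrite (_ : c x ^+ 2 * u x ^+ 2 / w x * (V x * w x) =
    c x ^+ 2 * u x * (V x * u x)); last by field.
  rewrite (addrC (_ * \sum_(i < d) (u x - _ + _))) addrKA.
  rewrite !mulr_sumr -sumrB; congr (0 <= _).
  by apply: eq_bigr => i _; rewrite /A; field.
have : 0 <= \sum_(i < d) \sum_(x \in box d N.+1)
    (A x (x + unitv i) + A (x + unitv i) x).
  rewrite (_ : \sum_(i < d) _ = \sum_(x \in box d N.+1)
      \sum_(i < d) (A x (x + unitv i) + A x (x - unitv i))); last first.
    rewrite fsbig_finite; last exact: finite_box.
    rewrite exchange_big /=; apply: eq_bigr => i _.
    rewrite -fsbig_finite; last exact: finite_box.
    rewrite !fsbig_split; try exact: finite_box.
    congr (_ + _); rewrite -(@sum_box_shift R d N (fun x => A x (x - unitv i)) i).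
      by apply: eq_fsbigr => x _; rewrite addrK.
    by move=> x /c0; rewrite /A => ->; rewrite expr0n mul0r.
  by rewrite fsumr_ge0.
move=> S0; rewrite -subr_ge0 -sumrB; apply: (le_trans S0).
apply: ler_sum => i _.
rewrite !fsbig_finite; try exact: finite_box.
rewrite -sumrB; apply: ler_sum => x _.
by rewrite /A edge_identity.
Qed.

(** A logarithmic cutoff without its normalising factor [1 / h_N]: dividing by
    [h_N] would only rescale the energy inequality. *)
Definition cutoff (R : realType) (d N : nat) (x : 'rV[int]_d) : R :=
  series harmonic N - series harmonic (minn (supn x) N).

Lemma cutoff0 (R : realType) (d N : nat) (x : 'rV[int]_d) :
  (N <= supn x)%N -> cutoff R N x = 0.
Proof. by move=> /minn_idPr; rewrite /cutoff => ->; rewrite subrr. Qed.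

Lemma sqr_harmonic_step (R : realType) (k a : nat) : (a <= k.+1)%N ->
  (series harmonic k.+1 - series harmonic k : R) ^+ 2 * (1 + a%:R) ^+ 2 <= 4.
Proof.
move=> ak; rewrite seriesSr addrC addKr /= -exprMn.
have k0 : 0 < k.+1%:R :> R by rewrite ltr0n.
have q0 : 0 <= k.+1%:R^-1 * (1 + a%:R) :> R.
  by rewrite mulr_ge0 ?invr_ge0 ?addr_ge0 // ltW.
have q2 : k.+1%:R^-1 * (1 + a%:R) <= 2 :> R.
  by rewrite mulrC ler_pdivrMr // nat1r -natrM ler_nat; lia.
rewrite [leRHS](_ : _ = 2 ^+ 2); last by ring.
by rewrite lerXn2r ?nnegrE.
Qed.

(** Sup norms of neighbours differ by at most 1, so the cutoff changes by at most
    one term of the harmonic series. *)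
Lemma cutoff_step (R : realType) (d N : nat) (x y : 'rV[int]_d) :
  (supn x <= (supn y).+1)%N -> (supn y <= (supn x).+1)%N ->
  (cutoff R N x - cutoff R N y) ^+ 2 * (1 + (supn x)%:R) ^+ 2 <=
  if (supn x <= N)%N then 4 else 0.
Proof.
move=> xy yx; case: leqP => [xN|Nx]; last first.
  by rewrite !cutoff0 ?subrr ?expr0n ?mul0r //; lia.
rewrite /cutoff opprB addrC addrA subrK.
have -> : minn (supn x) N = supn x by apply/minn_idPl.
have [e|[e|e]] : minn (supn y) N = supn x \/
  minn (supn y) N = (supn x).+1 \/ supn x = (minn (supn y) N).+1 by lia.
- by rewrite e subrr expr0n mul0r.
- by rewrite e; apply: sqr_harmonic_step; lia.
- by rewrite e -sqrrN opprB; apply: sqr_harmonic_step; lia.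
Qed.

Lemma growth_const_ge0 (R : realType) (d : nat) (u : 'rV[int]_d -> R) (C : R) :
  (forall x, u x ^+ 2 * (1 + (supn x)%:R) ^+ d <= C * (1 + (supn x)%:R) ^+ 2) ->
  0 <= C.
Proof.
move=> /(_ 0); rewrite (_ : supn 0 = 0%N) ?addr0 ?expr1n ?mulr1.
  by apply: le_trans; exact: sqr_ge0.
by apply/eqP; rewrite -leqn0; apply/supn_leP => i; rewrite mxE.
Qed.

(** The gradient of the cutoff at [x] is of order [1 / (1 + |x|)], so the growth
    bound turns the energy density into a multiple of [(1 + |x|)^(-d)], whose
    sum over a box is logarithmic. *)
Lemma cutoff_energy (R : realType) (d N : nat) (u : 'rV[int]_d -> R) (C : R) :
  (forall x, u x ^+ 2 * (1 + (supn x)%:R) ^+ d <= C * (1 + (supn x)%:R) ^+ 2) ->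
  \sum_(i < d) \sum_(x \in box d N.+1)
    u x * u (x + unitv i) * (cutoff R N x - cutoff R N (x + unitv i)) ^+ 2
  <= d%:R * (4 * C * (d.+1%:R * 2 ^+ d.+1 * series harmonic N.+1)).
Proof.
move=> hC.
pose b (x : 'rV[int]_d) : R :=
  if (supn x <= N)%N then 4 * C * (1 + (supn x)%:R) ^- d else 0.
have b0 x : (N < supn x)%N -> b x = 0 by rewrite /b ltnNge => /negbTE ->.
have C0 : 0 <= C := growth_const_ge0 hC.
have ub (x y : 'rV[int]_d) : (supn x <= (supn y).+1)%N -> (supn y <= (supn x).+1)%N ->
    u x ^+ 2 * (cutoff R N x - cutoff R N y) ^+ 2 <= b x.
  move=> xy yx; have := cutoff_step R N xy yx; rewrite /b.
  set D := (_ - _) ^+ 2; set q := 1 + _ => hD.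
  have q0 : 0 < q by rewrite /q ltr_wpDr.
  have D0 : 0 <= D by exact: sqr_ge0.
  case: ifP hD => _ hD; last first.
    move: hD; rewrite pmulr_lle0 ?exprn_gt0 // => hD.
    by rewrite (_ : D = 0) ?mulr0 //; apply/eqP; rewrite eq_le hD.
  rewrite ler_pdivlMr ?exprn_gt0 // mulrAC.
  apply: (le_trans (ler_wpM2r D0 (hC x))).
  rewrite -mulrA [4 * C]mulrC; apply: ler_wpM2l => //.
  by rewrite mulrC.
have step i x : u x * u (x + unitv i) *
    (cutoff R N x - cutoff R N (x + unitv i)) ^+ 2 <=
    2^-1 * b x + 2^-1 * b (x + unitv i).
  have [h1 h2] := supn_step x i.
  have := ub _ _ h1 h2; have := ub _ _ h2 h1.
  have := mulr_ge0 (sqr_ge0 (u x - u (x + unitv i)))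
    (sqr_ge0 (cutoff R N x - cutoff R N (x + unitv i))).
  move: (cutoff R N x) (cutoff R N (x + unitv i)) => p q; lra.
have i_le i : \sum_(x \in box d N.+1)
    u x * u (x + unitv i) * (cutoff R N x - cutoff R N (x + unitv i)) ^+ 2
    <= 4 * C * (d.+1%:R * 2 ^+ d.+1 * series harmonic N.+1).
  apply: (le_trans (ler_sum_box N.+1 (step i))).
  rewrite fsbig_split; last exact: finite_box.
  rewrite -!mulr_fsumr (@sum_box_shift R d N b i b0) /= -mulrDl.
  rewrite (_ : 2^-1 + 2^-1 = 1) ?mul1r; last by lra.
  rewrite -(@fsbig_widen _ _ _ _ (box d N)); last 2 first.
  - by move=> x; rewrite /box /=; lia.
  - by move=> x [_ /negP]; rewrite -ltnNge => /b0.
  rewrite (@eq_fsbigr _ _ _ _ _ (fun x => 4 * C * (1 + (supn x)%:R) ^- d)).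
    rewrite -mulr_fsumr ler_wpM2l ?mulr_ge0 //; exact: sum_box_weight.
  by move=> x; rewrite inE /b => ->.
apply: (le_trans (ler_sum _ (fun i _ => i_le i))).
by rewrite sumr_const card_ord -[leLHS]mulr_natl.
Qed.

(** * Solutions of critical growth are multiples of the positive supersolution *)

Lemma harmonic_unbounded (R : realType) (K : R) (n : nat) :
  exists2 N, (n <= N)%N & K < series harmonic N.
Proof.
have nd : nondecreasing_seq (series (@harmonic R)).
  by apply: nondecreasing_series => i _ _; exact: harmonic_ge0.
have [N hN] : exists N, K < series (@harmonic R) N.
  apply: contrapT => /forallNP hK; apply: (@dvg_harmonic R).
  apply: nondecreasing_is_cvgn => //; exists K => _ [N _ <-].
  by have /negP := hK N; rewrite -leNgt.
exists (maxn n N); first exact: leq_maxl.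
by apply: (lt_le_trans hN); apply: nd; exact: leq_maxr.
Qed.

(** At a zero of [w] the inequality [H w >= 0] says that a sum of nonpositive
    terms is nonnegative, so [w] vanishes at all neighbours, hence everywhere. *)
Lemma supersolution_gt0 (R : realType) (d : nat) (V w : 'rV[int]_d -> R) :
  (exists x, w x != 0) -> (forall x, 0 <= w x) ->
  (forall x, 0 <= schrodinger V w x) -> forall x, 0 < w x.
Proof.
move=> [x0 wx0] w0 Hw x; rewrite lt_neqAle w0 andbT eq_sym.
have step y : w y = 0 -> forall i, w (y + unitv i) = 0 /\ w (y - unitv i) = 0.
  move=> wy; have := Hw y; rewrite /schrodinger wy mulr0 addr0 laplacianE wy.
  under eq_bigr do rewrite !sub0r -opprD.
  rewrite sumrN oppr_ge0 => s0 i.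
  have /eqP : \sum_(i < d) (w (y + unitv i) + w (y - unitv i)) = 0.
    by apply/eqP; rewrite eq_le s0 sumr_ge0 // => j _; rewrite addr_ge0.
  rewrite psumr_eq0 => [|j _]; last by rewrite addr_ge0.
  move=> /allP /(_ i (mem_index_enum _)) /=.
  by rewrite paddr_eq0 // => /andP[/eqP ? /eqP ?].
apply: contra wx0 => /eqP wx; apply/eqP.
apply: (@lattice_connected _ (fun y => w y = 0)) wx => y i; split=> [/step/(_ i)[]//|].
by move=> /step/(_ i)[_]; rewrite addrK.
Qed.

Lemma eq0_of_sqr_le_linear (R : realType) (a b M : R) :
  (forall K, exists2 H, K < H & (H * a - b) ^+ 2 <= M * (H + 1)) -> a = 0.
Proof.
move=> hH; apply/eqP; apply: contrapT => /negP a0.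
have a2 : 0 < a ^+ 2 by rewrite exprn_even_gt0.
have [H] := hH (Num.max 1 ((2 * `|M| + 2 * (b * a)) / a ^+ 2)).
rewrite gt_max ltr_pdivrMr // => /andP[H1 H2] HM.
have MM : M <= `|M| := ler_norm M.
have M0 : 0 <= `|M| := normr_ge0 M.
have : H * (2 * `|M| + 2 * (b * a)) < H * (H * a ^+ 2) by rewrite ltr_pM2l; lra.
have : M * (H + 1) <= `|M| * (H + 1) by rewrite ler_wpM2r; lra.
have : `|M| * 1 <= `|M| * H by rewrite ler_wpM2l; lra.
have := sqr_ge0 b.
lra.
Qed.

Lemma le_term_sum_box (R : realType) (d N : nat) (F : 'I_d -> 'rV[int]_d -> R) i x :
  (forall j y, 0 <= F j y) -> (supn x <= N)%N ->
  F i x <= \sum_(j < d) \sum_(y \in box d N) F j y.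
Proof.
move=> F0 xN; rewrite (bigD1 i) //= (fsbigD1 x) //=; last exact: finite_box.
rewrite -addrA lerDl addr_ge0 // ?fsumr_ge0 // sumr_ge0 // => j _.
by rewrite fsumr_ge0.
Qed.

(** A Liouville comparison principle. Across an edge where [u / w] jumps, the
    energy would grow quadratically in [h_N], but it is bounded linearly. *)
Lemma harmonic_proportional (R : realType) (d : nat) (V u w : 'rV[int]_d -> R)
    (C : R) :
  (forall x, 0 < w x) -> (forall x, 0 <= schrodinger V w x) ->
  schrodinger_harmonic V u ->
  (forall x, u x ^+ 2 * (1 + (supn x)%:R) ^+ d <= C * (1 + (supn x)%:R) ^+ 2) ->
  forall x y, u x / w x = u y / w y.
Proof.
move=> w0 Hw Hu hC x y.
suff step z i : u z / w z = u (z + unitv i) / w (z + unitv i).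
  apply: (@lattice_connected _ (fun z => u x / w x = u z / w z)) (erefl _).
  by move=> z i; rewrite (step z i).
set g := fun z => u z / w z; rewrite -!/(g _).
apply/eqP; rewrite -subr_eq0; apply/eqP.
pose h (v : 'rV[int]_d) : R := series harmonic (supn v : nat).
pose K : R := d%:R * (4 * C * (d.+1%:R * 2 ^+ d.+1)).
have ww : 0 < w z * w (z + unitv i) by rewrite mulr_gt0.
apply: (@eq0_of_sqr_le_linear R (g z - g (z + unitv i))
  (h z * g z - h (z + unitv i) * g (z + unitv i))
  (K / (w z * w (z + unitv i)))) => L.
have [N hN HN] := harmonic_unbounded L (maxn (supn z) (supn (z + unitv i))).
exists (series harmonic N) => //.
rewrite mulrAC ler_pdivlMr // mulrC.
have cutE v : (supn v <= N)%N -> cutoff R N v = series harmonic N - h v.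
  by move=> /minn_idPl; rewrite /cutoff => ->.
have zN : (supn z <= N)%N by lia.
have z'N : (supn (z + unitv i) <= N)%N by lia.
have C0 : 0 <= C := growth_const_ge0 hC.
have K0 : 0 <= K by rewrite /K !mulr_ge0.
have upper := le_trans (energy_le w0 Hw Hu
    (fun y hy => cutoff0 R (ltnW hy))) (cutoff_energy N hC).
have H1 : series harmonic N.+1 <= series harmonic N + 1 :> R.
  by rewrite seriesSr lerD2l /= invf_le1 ?ler1n.
apply: le_trans (_ : _ <= K * series harmonic N.+1) _; last exact: ler_wpM2l.
rewrite (_ : K * _ = d%:R *
  (4 * C * (d.+1%:R * 2 ^+ d.+1 * series harmonic N.+1))); last by rewrite /K; ring.
apply: le_trans upper.
rewrite (_ : _ * (g z - _) - _ = cutoff R N z * g z -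
  cutoff R N (z + unitv i) * g (z + unitv i)); last by rewrite !cutE //; ring.
pose F (j : 'I_d) y := w y * w (y + unitv j) *
  (cutoff R N y * g y - cutoff R N (y + unitv j) * g (y + unitv j)) ^+ 2.
apply: (@le_term_sum_box R d N.+1 F); last by lia.
move=> j v; apply: mulr_ge0; last exact: sqr_ge0.
by rewrite ltW // mulr_gt0.
Qed.

(** * The exponential subsolution *)

(** The odd terms of the two exponential series cancel and the even ones are
    nonnegative, so the partial sums of the series of [2 cosh t] increase. *)
Lemma two_cosh_ge (R : realType) (t : R) :
  2 + t ^+ 2 + t ^+ 4 / 12 <= expR t + expR (- t).
Proof.
pose s := (series (exp_coeff t) + series (exp_coeff (- t)))%R : R^nat.
have cvgs : s @ \oo --> expR t + expR (- t).
  by apply: cvgD; exact: is_cvg_series_exp_coeff.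
have sE n : s n = \sum_(0 <= k < n) (t ^+ k / k`!%:R + (- t) ^+ k / k`!%:R).
  by rewrite /s /series /= big_split.
have nds : nondecreasing_seq s.
  apply/nondecreasing_seqP => n; rewrite !sE big_nat_recr //= lerDl -mulrDl.
  rewrite divr_ge0 //; have [no|ne] := boolP (odd n).
    by rewrite exprNn -signr_odd no expr1 mulN1r subrr.
  rewrite exprNn -signr_odd (negbTE ne) expr0 mul1r -mulr2n mulrn_wge0 //.
  by rewrite exprn_even_ge0.
have := nondecreasing_cvgn_le nds (cvgP _ cvgs) 5; rewrite (cvg_lim _ cvgs) //.
apply: le_trans; rewrite sE /= !big_nat_recr //= big_nil !factS fact0.
rewrite !expr0 !expr1 !muln1 /=; lra.
Qed.

Lemma sqr_enorm_unitv (R : realType) (d : nat) (x : 'rV[int]_d) i (b : bool) :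
  enorm R (if b then x + unitv i else x - unitv i) ^+ 2 =
  enorm R x ^+ 2 + (if b then 2 else -2) * (x ord0 i)%:~R + 1.
Proof.
rewrite !sqr_enorm (bigD1 i) //= [in RHS](bigD1 i) //=.
rewrite (_ : \sum_(j < d | j != i) _ =
    \sum_(j < d | j != i) (x ord0 j)%:~R ^+ 2 :> R); last first.
  apply: eq_bigr => j ji; case: b; rewrite !mxE eqxx (negbTE ji) /=.
    by rewrite addr0.
  by rewrite subr0.
by case: b; rewrite !mxE !eqxx /= ?rmorphD ?rmorphB /=; ring.
Qed.

Definition decay (R : realType) (d : nat) (x : 'rV[int]_d) : R :=
  expR (- enorm R x).
Arguments decay R {d} x.

(** The inequality [z <= (z^2 + r^2) / (2 r)] for [r = |x|] and [z = |x +- e_i|]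
    bounds the norm of a neighbour by [r + 1 / (2 r) +- x_i / r]. *)
Lemma decay_step (R : realType) (d : nat) (x : 'rV[int]_d) i (b : bool) :
  0 < enorm R x ->
  decay R x * expR (- (2 * enorm R x)^-1) *
    expR ((if b then -1 else 1) * ((x ord0 i)%:~R / enorm R x)) <=
  decay R (if b then x + unitv i else x - unitv i).
Proof.
move=> r0; rewrite /decay -!expRD ler_expR.
have := sqr_enorm_unitv R x i b.
set z := enorm R (if b then _ else _) => zE.
have rn : enorm R x != 0 by rewrite gt_eqF.
have : z <= (z ^+ 2 + enorm R x ^+ 2) / (2 * enorm R x).
  rewrite ler_pdivlMr ?mulr_gt0 //.
  by have := sqr_ge0 (z - enorm R x); lra.
rewrite zE => hz; rewrite lerNr !opprD !opprK; apply: (le_trans hz).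
rewrite le_eqVlt; apply/orP; left; apply/eqP.
by case: b {z zE hz}; field.
Qed.

(** This is the Cauchy-Schwarz inequality for [t_i ^+ 2] against 1, in the form
    of a sum of squares of deviations from the mean [1 / d]. *)
Lemma sum_pow4_ge (R : realType) (d : nat) (t : 'I_d -> R) :
  \sum_(i < d) t i ^+ 2 = 1 -> 1 <= d%:R * \sum_(i < d) t i ^+ 4.
Proof.
move=> t1.
have d0 : (0 < d)%N.
  case: d t t1 => // t.
  by rewrite big_ord0 => /eqP; rewrite eq_sym oner_eq0.
have dn : d%:R != 0 :> R by rewrite pnatr_eq0 -lt0n.
have : 0 <= \sum_(i < d) (d%:R * t i ^+ 2 - 1) ^+ 2.
  by apply: sumr_ge0 => i _; exact: sqr_ge0.
rewrite (eq_bigr (fun i => d%:R * (d%:R * t i ^+ 4) - 2 * d%:R * t i ^+ 2 + 1));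
  last by move=> i _; ring.
rewrite big_split /= sumrB -!mulr_sumr t1 sumr_const card_ord mulr1.
rewrite -[1 *+ d]/(d%:R) (_ : _ - _ + _ =
  d%:R * (d%:R * (\sum_(i < d) t i ^+ 4) - 1)); last by ring.
by rewrite pmulr_rge0 ?subr_ge0 // ltr0n.
Qed.

(** With [t = x / |x|], the gain is the quartic term, at least [1 / (12 d)], and
    the loss is the factor [exp (- 1 / (2 |x|))] on a sum of size about
    [2 d + 1]; beyond radius [100 d^2] the gain wins. *)
Lemma decay_subsolution (R : realType) (d : nat) (x : 'rV[int]_d) :
  (0 < d)%N -> (100 * d * d)%:R <= enorm R x ->
  laplacian (decay R) x + decay R x <= 0.
Proof.
move=> d0 hr.
have r0 : 0 < enorm R x by apply: lt_le_trans hr; rewrite ltr0n; lia.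
have rn : enorm R x != 0 by rewrite gt_eqF.
pose t i := (x ord0 i)%:~R / enorm R x.
have t1 : \sum_(i < d) t i ^+ 2 = 1.
  under eq_bigr do rewrite /t expr_div_n.
  by rewrite -mulr_suml -sqr_enorm divff // sqrf_eq0.
have s0 : 0 < decay R x := expR_gt0 _.
set e := expR (- (2 * enorm R x)^-1).
have e_ge : 1 - (2 * enorm R x)^-1 <= e by exact: expR_ge1Dx.
have stepi i : decay R x - decay R (x + unitv i) + (decay R x - decay R (x - unitv i))
   <= decay R x * (2 - e * (2 + t i ^+ 2 + t i ^+ 4 / 12)).
  have := @decay_step R d x i true r0; have := @decay_step R d x i false r0.
  have : decay R x * e * (2 + t i ^+ 2 + t i ^+ 4 / 12) <=
     decay R x * e * (expR (t i) + expR (- t i)).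
    by rewrite ler_wpM2l ?two_cosh_ge // mulr_ge0 ?expR_ge0.
  rewrite /= -/e -/(t i) mulN1r mul1r; lra.
set q := \sum_(i < d) t i ^+ 4.
have hq : 1 <= d%:R * q by exact: sum_pow4_ge.
have hs : laplacian (decay R) x <=
    decay R x * (2 * d%:R - e * (2 * d%:R + 1 + q / 12)).
  rewrite laplacianE.
  have -> : decay R x * (2 * d%:R - e * (2 * d%:R + 1 + q / 12)) =
      \sum_(i < d) decay R x * (2 - e * (2 + t i ^+ 2 + t i ^+ 4 / 12)).
    rewrite -mulr_sumr sumrB -mulr_sumr !big_split /= t1 -mulr_suml.
    by rewrite !sumr_const card_ord /q; ring.
  by apply: ler_sum => i _; exact: stepi.
suff : 2 * d%:R - e * (2 * d%:R + 1 + q / 12) + 1 <= 0.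
  move=> h; have := ler_wpM2l (ltW s0) h; lra.
have D0 : 0 < d%:R :> R by rewrite ltr0n.
have D1 : 1 <= d%:R :> R by rewrite ler1n.
have Dn : d%:R != 0 :> R by rewrite gt_eqF.
pose v : R := d%:R^-1.
have v0 : 0 < v by rewrite invr_gt0.
have v1 : v <= 1 by rewrite invf_le1.
have vq : v <= q by rewrite /v -[leLHS]mulr1 mulrC ler_pdivrMr // mulrC.
have eta_le : (2 * enorm R x)^-1 <= v ^+ 2 / 200.
  rewrite (_ : v ^+ 2 / 200 = (2 * (100 * d * d)%:R)^-1).
    by rewrite lef_pV2 ?posrE ?mulr_gt0 ?ler_pM2l // ltr0n; lia.
  by rewrite /v !natrM; field.
move: (2 * enorm R x)^-1 e_ge eta_le => eta e_ge eta_le.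
have vv : v ^+ 2 <= v by rewrite expr2 ler_piMr // ltW.
have e1 : 0 <= 1 - eta by lra.
have h1 : (1 - eta) * (2 * d%:R + 1 + v / 12) <= e * (2 * d%:R + 1 + q / 12).
  apply: ler_pM => //; lra.
have h2 : eta * (2 * d%:R + 1 + v / 12) <= v ^+ 2 / 200 * (2 * d%:R + 1 + v / 12).
  by apply: ler_wpM2r; lra.
have h3 : v ^+ 2 / 200 * (2 * d%:R + 1 + v / 12) =
   v / 100 + v ^+ 2 / 200 + v ^+ 2 * v / 2400 by rewrite /v; field.
have h4 : v ^+ 2 * v <= v ^+ 2 * 1 by rewrite ler_wpM2l ?sqr_ge0.
lra.
Qed.

(** * Comparison and growth at infinity *)

Lemma supn_le_enorm (R : realType) (d : nat) (x : 'rV[int]_d) :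
  (supn x)%:R <= enorm R x.
Proof.
have xi i : `|x ord0 i|%N%:R <= enorm R x.
  rewrite -(@ler_pXn2r _ 2) ?nnegrE ?enorm_ge0 // sqr_enorm (bigD1 i) //=.
  rewrite natr_absz intr_norm -normrX ger0_norm ?sqr_ge0 // lerDl.
  by apply: sumr_ge0 => j _; exact: sqr_ge0.
rewrite /supn; elim/big_ind: _ => // [|m n hm hn]; first exact: enorm_ge0.
by rewrite /maxn; case: ifP.
Qed.

Lemma finite_argmin (R : realType) (T : choiceType) (A : set T) (f : T -> R) x0 :
  finite_set A -> A x0 -> exists2 x, A x & forall y, A y -> f x <= f y.
Proof.
move=> fA Ax0.
have [s AE] : exists s : seq T, A = [set` s] by apply/finite_seqP.
rewrite AE in Ax0 *; elim: s x0 Ax0 {AE fA} => // a s IH x0 _.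
have [->|[b sb]] : s = [::] \/ exists b, b \in s.
- by case: s {IH} => [|b s]; [left | right; exists b; rewrite mem_head].
- by exists a => [|y]; rewrite /= ?mem_head // inE => /eqP ->.
have [x /= xs hx] := IH b sb.
have [ax|xa] := leP (f a) (f x).
  exists a; rewrite /= ?mem_head // => y /=; rewrite inE => /orP[/eqP ->//|ys].
  exact: le_trans ax (hx _ ys).
exists x; rewrite /= ?inE ?xs ?orbT // => y /=; rewrite inE => /orP[/eqP ->|].
  exact: ltW.
exact: hx.
Qed.

Lemma decay_vanishes (R : realType) (d : nat) (eta : R) : 0 < eta ->
  exists m, forall x : 'rV[int]_d, eta <= decay R x -> box d m x.
Proof.
move=> eta0; exists (Num.truncn eta^-1) => x hx.
rewrite /box /= truncn_ge_nat; last by rewrite invr_ge0 ltW.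
apply: (le_trans (supn_le_enorm R x)).
rewrite -[leRHS]mul1r ler_pdivlMr // mulrC.
have := expR_ge1Dx (enorm R x); move: hx; rewrite /decay expRN.
have e0 := expR_gt0 (enorm R x).
rewrite -[_^-1]mul1r ler_pdivlMr // => h1 h2.
have := ler_wpM2l (ltW eta0) h2; lra.
Qed.

(** The maximum principle. If [p - p(z) decay], where [z] minimises [p] on the
    ball, were negative somewhere, it would attain a negative minimum because
    [decay] vanishes at infinity. That minimum lies outside the ball since
    [decay <= 1], and there [Delta + 1] would be negative on the difference. *)
Lemma decay_le_supersolution (R : realType) (d : nat) (p : 'rV[int]_d -> R) :
  (0 < d)%N -> (forall x, 0 < p x) -> (forall x, 0 <= laplacian p x + p x) ->
  exists2 eps, 0 < eps & forall x, eps * decay R x <= p x.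
Proof.
move=> d0 p0 Hp; pose n := (100 * d * d)%N.
have box0 : box d n 0 by apply/supn_leP => i; rewrite mxE.
have [z _ zmin] := @finite_argmin R _ _ p _ (finite_box d n) box0.
exists (p z) => // x; rewrite leNgt; apply/negP => px.
pose f y := p y - p z * decay R y.
have fx0 : f x < 0 by rewrite /f subr_lt0.
have decay1 (y : 'rV[int]_d) : decay R y <= 1.
  by rewrite -expR0 ler_expR oppr_le0 enorm_ge0.
have eta0 : 0 < - f x / p z by rewrite divr_gt0 ?oppr_gt0.
have [m hm] := @decay_vanishes R d _ eta0.
have fbox y : f y <= f x -> box d m y.
  move=> fyx; apply: hm; rewrite ler_pdivrMr //.
  by have := p0 y; move: fyx; rewrite /f; lra.
have [y ym ymin] := @finite_argmin R _ _ f x (finite_box d m) (fbox _ (lexx _)).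
have fyx : f y <= f x by apply: ymin; exact: fbox.
have fmin v : f y <= f v.
  have [vx|/ltW xv] := leP (f v) (f x); first by apply: ymin; exact: fbox.
  exact: le_trans fyx xv.
have fy0 : f y < 0 by exact: le_lt_trans fx0.
have yn : n%:R <= enorm R y.
  apply: le_trans (supn_le_enorm _ _); rewrite ler_nat leqNgt; apply/negP => yn.
  have := zmin y (ltnW yn); have := ler_wpM2l (ltW (p0 z)) (decay1 y).
  by move: fy0; rewrite /f; lra.
have := @decay_subsolution R d y d0 yn; have := Hp y.
have : laplacian f y <= 0.
  rewrite laplacianE; apply: sumr_le0 => i _.
  by have := fmin (y + unitv i); have := fmin (y - unitv i); lra.
have -> : laplacian f y = laplacian p y - p z * laplacian (decay R) y.
  rewrite !laplacianE mulr_sumr -sumrB; apply: eq_bigr => i _.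
  by rewrite /f; ring.
move=> h1 h2 h3; have := ler_wpM2l (ltW (p0 z)) h3.
by move: fy0; rewrite /f; lra.
Qed.

Lemma liminf_infty_le (R : realType) (T : Type) (f : T -> R) (A : set T) (eps : R) :
  finite_set (~` A) -> (forall x, A x -> eps <= f x) ->
  (eps%:E <= liminf_infty f)%E.
Proof.
move=> fA hA; apply: le_trans (_ : _ <= ereal_inf ((EFin \o f) @` A))%E _.
  by apply: le_ereal_inf_tmp => _ [x Ax <-]; rewrite lee_fin; exact: hA.
by apply: ereal_sup_ubound; exists A.
Qed.

Lemma bigO_inftyP (R : realType) (T : Type) (f g : T -> R) :
  bigO_infty f g ->
  exists A M, finite_set (~` A) /\ forall x, A x -> `|f x| / `|g x| <= M.
Proof.
move=> /ereal_inf_lt [_ [A fA <-] supA].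
exists A.
have [[x Ax]|A0] := pselect (exists x, A x); last first.
  by exists 0; split=> // x Ax; case: A0; exists x.
have ub y : A y -> ((`|f y| / `|g y|)%:E <=
    ereal_sup ((EFin \o (fun x => `|f x| / `|g x|)%R) @` A))%E.
  by move=> Ay; apply: ereal_sup_ubound; exists y.
have := ub x Ax; case: ereal_sup supA ub => // M _ ub _.
by exists M; split=> // y /ub; rewrite lee_fin.
Qed.

Lemma finite_set_bounded_above (R : realType) (T : choiceType) (A : set T) (f : T -> R) :
  finite_set A -> exists M, forall x, A x -> f x <= M.
Proof.
move=> fA; have [[x0 Ax0]|A0] := pselect (exists x, A x); last first.
  by exists 0 => x Ax; case: A0; exists x.
have [x _ hx] := @finite_argmin R T A (fun x => - f x) x0 fA Ax0.
by exists (f x) => y /hx; rewrite lerN2.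
Qed.

(** A common form of both growth hypotheses, with integer exponents. For [d = 2]
    it is boundedness, and for [d = 1] it is weaker. For [d >= 3] it follows from
    the decay [|x|^((2-d)/2)]: the exponent is negative and the Euclidean norm
    is at least the sup norm. *)
Lemma growth_bound (R : realType) (d : nat) (u : 'rV[int]_d -> R) :
  (1 <= d)%N -> (d = 1%N \/ d = 2%N -> bounded_fun u) ->
  ((3 <= d)%N -> bigO_infty u (fun x => enorm R x `^ ((2 - d%:R) / 2))) ->
  exists C, forall x,
    u x ^+ 2 * (1 + (supn x)%:R) ^+ d <= C * (1 + (supn x)%:R) ^+ 2.
Proof.
move=> d1 ha hb; have [d3|d3] := leqP 3 d; last first.
  have [M [_ /(_ (M + 1) (ltac:(by rewrite ltrDl)))]] : bounded_fun u by apply: ha; lia.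
  move=> uM; exists ((M + 1) ^+ 2) => x.
  have {}uM : `|u x| <= M + 1 by exact: uM.
  apply: ler_pM; rewrite ?sqr_ge0 ?exprn_ge0 //.
    by rewrite -[u x ^+ 2]ger0_norm ?sqr_ge0 // normrX lerXn2r ?nnegrE // (le_trans _ uM).
  by apply: ler_weXn2l; rewrite ?lerDl //; lia.
have [A [M [fA hM]]] := bigO_inftyP (hb d3).
(* The origin is treated apart because 1 + |x| <= 2 |x| fails there. *)
have [M' hM'] := @finite_set_bounded_above R _ (~` A `|` [set 0])
  (fun x => u x ^+ 2 * (1 + (supn x)%:R) ^+ (d - 2))
  (ltac:(by rewrite finite_setU)).
exists (Num.max M' (M ^+ 2 * 2 ^+ (d - 2))) => x.
rewrite (_ : _ ^+ d = (1 + (supn x)%:R) ^+ (d - 2) * (1 + (supn x)%:R) ^+ 2);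
  last by rewrite -exprD subnK // ltnW.
rewrite mulrA.
apply: ler_wpM2r; first by rewrite exprn_ge0 // addr_ge0.
have [Bx|nBx] := pselect ((~` A `|` [set 0]) x).
  by apply: (le_trans (hM' x Bx)); rewrite le_max lexx.
rewrite le_max; apply/orP; right.
have Ax : A x by apply: contrapT => nAx; apply: nBx; left.
have x0 : x != 0 by apply/eqP => x0; apply: nBx; right.
have s1 : (1 <= supn x)%N.
  rewrite lt0n; apply: contra x0 => /eqP sx; apply/eqP/rowP => i.
  have : (supn x <= 0)%N by rewrite sx.
  by move=> /supn_leP/(_ i); rewrite leqn0 absz_eq0 mxE => /eqP.
have sr := supn_le_enorm R x.
have r1 : 1 <= enorm R x by apply: le_trans sr; rewrite ler1n.
have r0 : 0 < enorm R x by exact: lt_le_trans r1.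
have := hM x Ax.
rewrite [X in _ / X]ger0_norm ?powR_ge0 // ler_pdivrMr ?powR_gt0 // => uM.
have : u x ^+ 2 <= (M * enorm R x `^ ((2 - d%:R) / 2)) ^+ 2.
  rewrite -[u x ^+ 2]ger0_norm ?sqr_ge0 // normrX.
  by rewrite lerXn2r ?nnegrE // (le_trans _ uM).
rewrite exprMn -[(_ `^ _) ^+ 2]powR_mulrn ?powR_ge0 // -powRrM.
rewrite (_ : (2 - d%:R) / 2 * 2%:R = - (d - 2)%:R); last first.
  by rewrite natrB; [field | lia].
rewrite powRN powR_mulrn ?enorm_ge0 // => u2.
have sq : (1 + (supn x)%:R) ^+ (d - 2) <= 2 ^+ (d - 2) * enorm R x ^+ (d - 2).
  rewrite -exprMn lerXn2r ?nnegrE ?addr_ge0 ?mulr_ge0 ?enorm_ge0 //; lra.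
apply: (le_trans (ler_wpM2l (sqr_ge0 _) sq)).
rewrite mulrCA [leRHS]mulrC; apply: ler_wpM2l; first exact: exprn_ge0.
by rewrite -ler_pdivlMr ?exprn_gt0.
Qed.

(** * Vanishing of solutions that decay fast along a sequence *)

Theorem theorem4p1 (R : realType) (d : nat) (hd : (1 <= d)%N)
    (V u : 'rV[int]_d -> R)
    (hpos : positive_schrodinger V)
    (hV : forall x, V x <= 1)
    (hu : schrodinger_harmonic V u)
    (ha : d = 1%N \/ d = 2%N -> bounded_fun u)
    (hb : (3 <= d)%N ->
      bigO_infty u (fun x => enorm R x `^ ((2 - d%:R) / 2)))
    (hliminf : liminf_infty (fun x =>
      `|u x| * enorm R x `^ ((d%:R - 1) / 2) * expR (enorm R x)) = 0%E) :
  forall x, u x = 0.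
Proof.
have [w [wnz w_ge0 Hw]] := hpos.
have w0 := supersolution_gt0 wnz w_ge0 Hw.
have [C hC] := growth_bound hd ha hb.
pose c := u 0 / w 0.
have uE x : u x = c * w x.
  rewrite /c (harmonic_proportional w0 Hw hu hC 0 x) divfK //.
  by rewrite gt_eqF.
have [c0 x|cn0] := eqVneq c 0; first by rewrite uE c0 mul0r.
have cp : 0 < `|c| by rewrite normr_gt0.
pose p x := `|c| * w x.
have p0 x : 0 < p x by rewrite /p mulr_gt0.
have pE x : `|u x| = p x by rewrite uE normrM (gtr0_norm (w0 x)).
have lap_scale (a : R) x : laplacian (fun y => a * w y) x = a * laplacian w x.
  by rewrite !laplacianE mulr_sumr; apply: eq_bigr => i _; ring.
have Hw0 x : schrodinger V w x = 0.
  apply/eqP; have /eqP := hu x; rewrite (_ : schrodinger V u x = c * schrodinger V w x).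
    by rewrite mulf_eq0 (negbTE cn0).
  rewrite /schrodinger mulrDr -lap_scale uE; congr (_ + _); last by ring.
  by rewrite (_ : u = fun y => c * w y) //; apply/funext.
have Hp x : 0 <= laplacian p x + p x.
  rewrite lap_scale -mulrDr mulr_ge0 //.
  have := ler_wpM2r (w_ge0 x) (hV x); have := Hw0 x; rewrite /schrodinger; lra.
have [eps eps0 hp] := decay_le_supersolution hd p0 Hp.
suff : (eps%:E <= 0%E :> \bar R)%E by rewrite lee_fin leNgt eps0.
rewrite -hliminf.
apply: (@liminf_infty_le _ _ _ [set x | (1 <= supn x)%N]).
  apply: (@sub_finite_set _ _ (box d 0)); last exact: finite_box.
  by move=> x /negP; rewrite -ltnNge ltnS.
move=> x /= s1.
have r1 : 1 <= enorm R x.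
  by apply: le_trans (supn_le_enorm R x); rewrite ler1n.
have pow1 : 1 <= enorm R x `^ ((d%:R - 1) / 2).
  rewrite -[leLHS](powRr0 (enorm R x)) ler_powR // divr_ge0 ?subr_ge0 ?ler1n //.
rewrite pE.
have := hp x; rewrite /decay expRN ler_pdivrMr ?expR_gt0 // => hpx.
apply: (le_trans hpx); rewrite ler_pM2r ?expR_gt0 //.
by rewrite ler_peMr // ltW.
Qed.
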